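(* Let $\|\cdot\|_{\mathrm{x}}$ be a norm on $\mathbb{R}^m$ and $\|\cdot\|_{\mathrm{h}}$ a norm on $\mathbb{R}^n$. Let $h_f, h_0:\mathbb{R}^m\to\mathbb{R}^n$ be functions, let $\Delta h := h_f - h_0$, and let $L_d, L_0\ge 0$ be real numbers. Suppose that $h_f$ is $L_d$-Lipschitz-robust with respect to $h_0$ and that $h_0$ is $L_0$-Lipschitz, i.e. for all $\mathbf{x},\mathbf{x}'\in\mathbb{R}^m$, $$\|\Delta h(\mathbf{x})-\Delta h(\mathbf{x}')\|_{\mathrm{h}}\le L_d\|\mathbf{x}-\mathbf{x}'\|_{\mathrm{x}}\quad\text{and}\quad \|h_0(\mathbf{x})-h_0(\mathbf{x}')\|_{\mathrm{h}}\le L_0\|\mathbf{x}-\mathbf{x}'\|_{\mathrm{x}}.$$ Then $h_f$ is $(L_d+L_0)$-Lipschitz, i.e. $$\|h_f(\mathbf{x})-h_f(\mathbf{x}')\|_{\mathrm{h}}\le (L_d+L_0)\|\mathbf{x}-\mathbf{x}'\|_{\mathrm{x}}\quad\text{for all }\mathbf{x},\mathbf{x}'\in\mathbb{R}^m.$$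
   Context: $h_0$ is called the pre-trained model and $h_f$ the fine-tuned model; $\Delta h = h_f-h_0$ is called the difference function. The function $h_f$ is called $L_d$-Lipschitz-robust with respect to $h_0$ (with $L_d\ge 0$) if $\|\Delta h(\mathbf{x})-\Delta h(\mathbf{x}')\|_{\mathrm{h}}\le L_d\|\mathbf{x}-\mathbf{x}'\|_{\mathrm{x}}$ for all $\mathbf{x},\mathbf{x}'\in\mathbb{R}^m$, where $\|\cdot\|_{\mathrm{x}}$ is the input-space norm and $\|\cdot\|_{\mathrm{h}}$ is the feature-space norm. *)

(* Defs.v *)
From mathcomp Require Import all_boot all_order all_algebra.
From mathcomp Require Import reals.

Set Implicit Arguments.
Unset Strict Implicit.
Unset Printing Implicit Defensive.

Import Order.TTheory GRing.Theory Num.Theory.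
Local Open Scope ring_scope.

(* [normedModType] attaches a single canonical norm to a type (the sup norm for
   row vectors), so an arbitrary norm on R^n is a function satisfying the norm
   axioms.  For the same reason the library notation [k.-lipschitz f] does not
   apply, and Lipschitz continuity takes the two norms as parameters. *)
Record is_norm (R : realType) (n : nat) (N : 'rV[R]_n -> R) : Prop := IsNorm {
  is_norm_ge0 : forall x, 0 <= N x;
  is_norm_eq0 : forall x, N x = 0 -> x = 0;
  is_normZ : forall (a : R) x, N (a *: x) = `|a| * N x;
  is_normD : forall x y, N (x + y) <= N x + N y
}.

Definition lipschitz_wrt (R : realType) (m n : nat)
    (normx : 'rV[R]_m -> R) (normh : 'rV[R]_n -> R) (L : R)
    (f : 'rV[R]_m -> 'rV[R]_n) : Prop :=
  forall x x' : 'rV[R]_m, normh (f x - f x') <= L * normx (x - x').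

Definition diff_fun (R : realType) (m n : nat)
    (hf h0 : 'rV[R]_m -> 'rV[R]_n) : 'rV[R]_m -> 'rV[R]_n :=
  fun x => hf x - h0 x.

Definition lipschitz_robust (R : realType) (m n : nat)
    (normx : 'rV[R]_m -> R) (normh : 'rV[R]_n -> R) (Ld : R)
    (hf h0 : 'rV[R]_m -> 'rV[R]_n) : Prop :=
  lipschitz_wrt normx normh Ld (diff_fun hf h0).

(* Main.v *)
Require Import Defs.
From mathcomp Require Import all_boot all_order all_algebra.
From mathcomp Require Import reals.

Set Implicit Arguments.
Unset Strict Implicit.
Unset Printing Implicit Defensive.

Import Order.TTheory GRing.Theory Num.Theory.
Local Open Scope ring_scope.

(** Since [hf] is the sum of [diff_fun hf h0] and [h0], the triangle inequality for [normh] makes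
    their Lipschitz constants add. *)

Theorem lemma1 (R : realType) (m n : nat)
    (normx : 'rV[R]_m -> R) (normh : 'rV[R]_n -> R)
    (normxP : is_norm normx) (normhP : is_norm normh)
    (hf h0 : 'rV[R]_m -> 'rV[R]_n) (Ld L0 : R)
    (Ld_ge0 : 0 <= Ld) (L0_ge0 : 0 <= L0)
    (hf_robust : lipschitz_robust normx normh Ld hf h0)
    (h0_lip : lipschitz_wrt normx normh L0 h0) :
  lipschitz_wrt normx normh (Ld + L0) hf.
Proof.
move=> x x'.
have -> : hf x - hf x' =
    (diff_fun hf h0 x - diff_fun hf h0 x') + (h0 x - h0 x').
  (* Regrouping the four terms by argument, [x] against [x'], lets [h0] cancel inside each group. *)
  by rewrite addrACA -opprD /diff_fun !subrK.
(* Distributing [Ld + L0] gives one summand of the bound for each of the two increments. *)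
rewrite mulrDl; apply: le_trans (is_normD normhP _ _) _.
exact: lerD (hf_robust x x') (h0_lip x x').
Qed.
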